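(* Let $S$ be a $t$-splitting set of an integral domain $D$. If $D$ is a $v$-domain, then so is $D_S$.
   Context: Let $D$ be an integral domain with quotient field $K$. For a nonzero fractional ideal $A$ of $D$, $A^{-1}=\{x\in K : xA\subseteq D\}$, $A_v=(A^{-1})^{-1}$, and $A_t=\bigcup\{J_v : J \text{ a nonzero finitely generated subideal of } A\}$. $D$ is a $v$-domain if for every nonzero finitely generated ideal $A$ of $D$ one has $(AA^{-1})^{-1}=D$, equivalently $(AA^{-1})_v=D$. Multiplicative sets do not contain $0$; $D_S$ is the ring of fractions of $D$ with respect to $S$. A multiplicative set $S$ of $D$ is a $t$-splitting set if for every $d\in D\setminus\{0\}$ there are integral ideals $A,B$ of $D$ such that $dD=(AB)_t$, $B_t\cap S\neq\emptyset$, and $(A,s)_t=D$ for all $s\in S$, where $(A,s)=A+sD$. *)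

(* Defs.v *)
From HB Require Import structures.
From mathcomp Require Import all_boot all_order all_algebra.
From mathcomp Require Import boolp classical_sets.

Set Implicit Arguments.
Unset Strict Implicit.
Unset Printing Implicit Defensive.

Import GRing.Theory.
Local Open Scope classical_set_scope.
Local Open Scope ring_scope.
Local Notation "x %:F" := (tofrac x).

(* Ideals of D, integral or fractional, are represented as subsets of the
   quotient field K = {fraction D}, with D identified with its image [dom] under
   the embedding %:F. The library's [idealr] predicates only cover proper
   integral ideals. *)
Section Ideals.
Variable D : idomainType.
Local Notation K := {fraction D}.
Implicit Types (A B J : set K) (x : K) (d : D).

Definition dom : set K := range (@tofrac D).

Definition is_submodule A : Prop :=
  [/\ A 0, forall x y, A x -> A y -> A (x + y)
    & forall d x, A x -> A (d%:F * x)].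

(* The zero ideal is excluded: the v- and t-operations act on nonzero
   fractional ideals only. *)
Definition fractional_ideal A : Prop :=
  [/\ is_submodule A, exists2 x, A x & x != 0
    & exists2 d, d != 0 & forall x, A x -> dom (d%:F * x)].

Definition integral_ideal A : Prop := fractional_ideal A /\ A `<=` dom.

Definition ideal_span n (g : 'I_n -> K) : set K :=
  [set x | exists c : 'I_n -> D, x = \sum_(i < n) (c i)%:F * g i].

Definition fin_gen A : Prop := exists n (g : 'I_n -> K), A = ideal_span g.

Definition principal d : set K := [set d%:F * x | x in dom].

Definition ideal_add A B : set K := [set x + y | x in A & y in B].

Definition ideal_mul A B : set K :=
  [set x | exists n (a b : 'I_n -> K),
     [/\ forall i, A (a i), forall i, B (b i)
       & x = \sum_(i < n) a i * b i]].

Definition ideal_inv A : set K := [set x | forall a, A a -> dom (x * a)].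

Definition v_op A : set K := ideal_inv (ideal_inv A).

Definition t_op A : set K :=
  [set x | exists J,
     [/\ fractional_ideal J, fin_gen J, J `<=` A & v_op J x]].

Definition v_domain : Prop :=
  forall A, integral_ideal A -> fin_gen A ->
    ideal_inv (ideal_mul A (ideal_inv A)) = dom.

Definition t_splitting (S : {pred D}) : Prop :=
  forall d, d != 0 ->
    exists A B,
      [/\ integral_ideal A, integral_ideal B,
          principal d = t_op (ideal_mul A B),
          exists2 s, s \in S & t_op B s%:F
        & forall s, s \in S -> t_op (ideal_add A (principal s)) = dom].

End Ideals.

(* D_S, realized as the subring {a/s | a in D, s in S} of {fraction D}. Since
   0^-1 = 0 in {fraction D}, this is a subring even if 0 is in S, although it is
   then not the ring of fractions (which would be the zero ring). *)
Section Localization.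
Variables (D : idomainType) (S : mulrClosed D).
Local Notation K := {fraction D}.

Definition is_S_fraction : {pred K} :=
  fun x => `[< exists a s, s \in S /\ x = a%:F / s%:F >].

Lemma is_S_fractionP x :
  reflect (exists a s, s \in S /\ x = a%:F / s%:F) (x \in is_S_fraction).
Proof. exact: asboolP. Qed.

Lemma is_S_fraction_subring : subring_closed is_S_fraction.
Proof.
split.
- apply/is_S_fractionP; exists 1, 1; split; first exact: rpred1.
  by rewrite rmorph1 divr1.
- move=> x y /is_S_fractionP [a [s [Ss ->]]] /is_S_fractionP [b [t [St ->]]].
  have [->|s0] := eqVneq s 0.
    apply/is_S_fractionP; exists (- b), t; split=> //.
    by rewrite rmorph0 invr0 mulr0 sub0r rmorphN mulNr.
  have [->|t0] := eqVneq t 0.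
    by apply/is_S_fractionP; exists a, s; rewrite rmorph0 invr0 mulr0 subr0.
  apply/is_S_fractionP; exists (a * t - b * s), (s * t).
  split; first exact: rpredM.
  rewrite -mulNr addf_div ?tofrac_eq0 // !rmorphM rmorphB !rmorphM.
  by rewrite mulNr.
- move=> x y /is_S_fractionP [a [s [Ss ->]]] /is_S_fractionP [b [t [St ->]]].
  apply/is_S_fractionP; exists (a * b), (s * t); split; first exact: rpredM.
  by rewrite mulf_div !rmorphM.
Qed.

HB.instance Definition _ :=
  GRing.isSubringClosed.Build K is_S_fraction is_S_fraction_subring.

Record localization := Localization {
  loc_val : K;
  loc_valP : loc_val \in is_S_fraction }.

HB.instance Definition _ := [isSub for loc_val].
HB.instance Definition _ := [Choice of localization by <:].
HB.instance Definition _ := [SubChoice_isSubComNzRing of localization by <:].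

Definition loc_unit : {pred localization} :=
  fun x => (val x != 0) && ((val x)^-1 \in is_S_fraction).

Definition loc_inv (x : localization) : localization :=
  if x \in loc_unit then insubd x (val x)^-1 else x.

Lemma loc_mulVx : {in loc_unit, left_inverse 1 loc_inv *%R}.
Proof.
move=> x Ux; apply: val_inj; rewrite rmorphM rmorph1 /= /loc_inv Ux.
by move/andP: Ux => [x0 xS]; rewrite [loc_val _](insubdK x xS) mulVf.
Qed.

Lemma loc_unitPl (x y : localization) : y * x = 1 -> loc_unit x.
Proof.
move=> /(congr1 val); rewrite rmorphM rmorph1 /= => yx1.
have x0 : val x != 0.
  by apply/eqP=> x0; move/eqP: yx1; rewrite x0 mulr0 eq_sym oner_eq0.
rewrite /loc_unit x0 /=.
suff -> : (val x)^-1 = val y by exact: valP.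
by apply: (mulIf x0); rewrite mulVf.
Qed.

Lemma loc_inv_out : {in [predC loc_unit], loc_inv =1 id}.
Proof. by move=> x /negPf; rewrite /loc_inv => ->. Qed.

HB.instance Definition _ :=
  GRing.ComNzRing_hasMulInverse.Build localization
    loc_mulVx loc_unitPl loc_inv_out.

Lemma loc_integral : GRing.integral_domain_axiom localization.
Proof.
move=> x y /(congr1 val); rewrite rmorphM rmorph0 /= => /eqP.
by rewrite mulf_eq0 -!(inj_eq val_inj) !rmorph0.
Qed.

HB.instance Definition _ :=
  GRing.ComUnitRing_isIntegral.Build localization loc_integral.

End Localization.

(* Main.v *)
From HB Require Import structures.
Require Import Defs.
From mathcomp Require Import all_boot all_order all_algebra.
From mathcomp Require Import boolp classical_sets generic_quotient ring.

(** Let [I = A A^{-1}] for a nonzero finitely generated ideal [A] of [D]. Being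
    a v-domain means that [I^{-1} = D], and what has to be shown is that
    [(I D_S)^{-1} = D_S]. This is not automatic, since [I] need not be finitely
    generated. It holds for t-splitting [S] and every integral ideal [I] with
    [I^{-1} = D] ([fraction_inv_local]): write [x = a / d] with [x I] inside
    [D_S], and split [dD = (EF)_t]. Every [y] in [I] has some [t] in [S] with
    [t a y] in [dD], hence in [E_v]. As [(E, t)_v = D], the factor [t] can be
    cancelled, so [a I] is inside [E_v]; as [I^{-1} = D], so is [a]. Finally
    [F_v] meets [S] in some [s], and [s a] lies in [E_v F_v], hence in
    [(EF)_v = dD]. So [x = (s a / d) / s] is in [D_S]. Only the consequences of
    t-splitting for the v-operation are used ([t_splitting_v]).

    A nonzero finitely generated ideal of [D_S] becomes, after clearing
    denominators by an element of [S], generated by the images of finitely many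
    elements of [D]; these span the ideal [A]. Elements of [A^{-1}] map into the
    inverse of the extended ideal, so the product ideal in [D_S] contains
    [A A^{-1}], and its inverse is controlled by the previous paragraph.

    The ring [D_S] has its own fraction field, distinct from that of [D] as a
    type. The two are identified by extending the embedding of [D] into
    [D_S] ([fraction_extension], [fraction_loc_iso]). *)

Set Implicit Arguments.
Unset Strict Implicit.
Unset Printing Implicit Defensive.

Import GRing.Theory.
Local Open Scope classical_set_scope.
Local Open Scope ring_scope.
Local Notation "x %:F" := (tofrac x).

(** * Universal property of the fraction field *)

Section FractionField.
Variable R : idomainType.

Lemma fraction_repr (x : {fraction R}) :
  x = (\n_(repr x))%:F / (\d_(repr x))%:F.
Proof.
have dN0 := denom_ratioP (repr x).
rewrite -[LHS]reprK; unlock tofrac.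
rewrite -[X in _ * X]FracField.pi_inv -[RHS]FracField.pi_mul.
rewrite /FracField.mulf /FracField.invf !numden_Ratio ?oner_neq0 //.
by rewrite mulr1 mul1r Ratio_numden.
Qed.

Variables (F : fieldType) (f : {rmorphism R -> F}).
Hypothesis f_inj : injective f.

Lemma fraction_extension :
  exists phi : {rmorphism {fraction R} -> F}, forall a, phi a%:F = f a.
Proof.
pose h (x : {fraction R}) : F := f (\n_(repr x)) / f (\d_(repr x)).
have fN0 b : b != 0 -> f b != 0 by rewrite -(rmorph0 f) (inj_eq f_inj).
have hE a b : b != 0 -> h (a%:F / b%:F) = f a / f b.
  move=> b0; rewrite /h; set r := repr _.
  have r0 : \d_r != 0 := denom_ratioP r.
  have : a%:F / b%:F = (\n_r)%:F / (\d_r)%:F by exact: fraction_repr.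
  move/eqP; rewrite eqr_div ?tofrac_eq0 // -!rmorphM tofrac_eq.
  move=> /eqP/(congr1 f); rewrite !rmorphM => e; apply/eqP.
  by rewrite eqr_div ?fN0 // -e.
have ex (x : {fraction R}) : exists a b : R, b != 0 /\ x = a%:F / b%:F.
  exists \n_(repr x), \d_(repr x).
  by split; [exact: denom_ratioP | exact: fraction_repr].
have hF a : h a%:F = f a.
  rewrite -[a%:F]divr1 -(rmorph1 (@tofrac _)) hE ?oner_neq0 //.
  by rewrite rmorph1 divr1.
have hB : zmod_morphism h.
  move=> x y; have [a [b [b0 ->]]] := ex x; have [c [d [d0 ->]]] := ex y.
  have -> : a%:F / b%:F - c%:F / d%:F = (a * d - c * b)%:F / (b * d)%:F.
    by rewrite -mulNr addf_div ?tofrac_eq0 // rmorphB !rmorphM mulNr.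
  rewrite !hE ?mulf_neq0 // -[in RHS]mulNr addf_div ?fN0 // rmorphB !rmorphM.
  by rewrite mulNr.
have hM : monoid_morphism h.
  split=> [|x y]; first by rewrite -(rmorph1 (@tofrac _)) hF rmorph1.
  have [a [b [b0 ->]]] := ex x; have [c [d [d0 ->]]] := ex y.
  by rewrite mulf_div -!rmorphM !hE ?mulf_neq0 // !rmorphM mulf_div.
pose ha := GRing.isZmodMorphism.Build _ _ h hB.
pose hm := GRing.isMonoidMorphism.Build _ _ h hM.
pose phi : {rmorphism {fraction R} -> F} := HB.pack h ha hm.
by exists phi.
Qed.

End FractionField.

(** * The v- and t-operations *)

Section Ideals.
Variable D : idomainType.
Local Notation K := {fraction D}.
Implicit Types (A B I J : set K) (x y : K) (d : D).

Lemma dom_tofrac d : dom d%:F.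
Proof. by exists d. Qed.

Lemma dom0 : @dom D 0.
Proof. by exists 0; rewrite ?rmorph0. Qed.

Lemma domD x y : dom x -> dom y -> dom (x + y).
Proof. by move=> [a _ <-] [b _ <-]; exists (a + b); rewrite ?rmorphD. Qed.

Lemma domM x y : dom x -> dom y -> dom (x * y).
Proof. by move=> [a _ <-] [b _ <-]; exists (a * b); rewrite ?rmorphM. Qed.

Lemma dom_sum n (F : 'I_n -> K) : (forall i, dom (F i)) -> dom (\sum_i F i).
Proof. by move=> HF; apply: big_ind => //; [exact: dom0 | exact: domD]. Qed.

Lemma dom_inv_mul A : @dom _ `<=` ideal_inv (ideal_mul A (ideal_inv A)).
Proof.
move=> x Dx _ [n [a [b [Aa Ab ->]]]]; apply: domM => //.
by apply: dom_sum => i; rewrite mulrC; exact: Ab.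
Qed.

Lemma mul_inv_dom A : ideal_mul A (ideal_inv A) `<=` @dom _.
Proof.
by move=> y Iy; have := dom_inv_mul (dom_tofrac 1) Iy; rewrite rmorph1 mul1r.
Qed.

Lemma v_opS A B : A `<=` B -> v_op A `<=` v_op B.
Proof. by move=> AB x vx y By; apply: vx => a /AB; exact: By. Qed.

Lemma t_op_sub_v_op A : t_op A `<=` v_op A.
Proof. by move=> x [J [_ _ JA]]; exact: v_opS. Qed.

Lemma sub_v_op A : A `<=` v_op A.
Proof. by move=> a Aa y; rewrite mulrC; exact. Qed.

Lemma span_submodule n (g : 'I_n -> K) : is_submodule (ideal_span g).
Proof.
split=> [|_ _ [c ->] [c' ->]|d _ [c ->]].
- by exists (fun=> 0); rewrite big1 // => i _; rewrite rmorph0 mul0r.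
- exists (fun i => c i + c' i); rewrite -big_split; apply: eq_bigr => i _.
  by rewrite rmorphD mulrDl.
- exists (fun i => d * c i); rewrite mulr_sumr; apply: eq_bigr => i _.
  by rewrite rmorphM mulrA.
Qed.

Lemma span_gen n (g : 'I_n -> K) i : ideal_span g (g i).
Proof.
exists (fun j => (j == i)%:R); rewrite (bigD1 i) //= eqxx rmorph1 mul1r.
by rewrite big1 ?addr0 // => j /negbTE ->; rewrite rmorph0 mul0r.
Qed.

Lemma span_integral n (c : 'I_n -> D) i :
  c i != 0 -> integral_ideal (ideal_span (fun j => (c j)%:F)).
Proof.
move=> ci0.
have spD : ideal_span (fun j => (c j)%:F) `<=` @dom _.
  by move=> _ [e ->]; apply: dom_sum => j; apply: domM; exact: dom_tofrac.
split=> //; split; first exact: span_submodule.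
- by exists (c i)%:F; [exact: (span_gen (fun j => (c j)%:F)) | rewrite tofrac_eq0].
- exists 1; first exact: oner_neq0.
  by move=> x /spD; rewrite rmorph1 mul1r.
Qed.

(** A finitely generated ideal witnessing membership in [t_op A] must be
    nonzero; hence the exclusion of [x = 0]. *)
Lemma integral_sub_t_op A x : is_submodule A -> A `<=` @dom _ -> x != 0 ->
  A x -> t_op A x.
Proof.
move=> [A0 AD AM] AsD + Ax; have [c _ xE] := AsD _ Ax.
rewrite -xE tofrac_eq0 => c0; pose g (_ : 'I_1) := c.
exists (ideal_span (fun j => (g j)%:F)); split.
- by have [] := @span_integral _ g ord0 c0.
- by exists 1%N, (fun j => (g j)%:F).
- by move=> _ [e ->]; rewrite big_ord1 xE; exact: AM.
- by apply: sub_v_op; exact: (span_gen (fun j => (g j)%:F) ord0).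
Qed.

Lemma submodule_sum A n (F : 'I_n -> K) :
  is_submodule A -> (forall i, A (F i)) -> A (\sum_i F i).
Proof. by move=> [A0 AD _] AF; apply: big_ind. Qed.

Lemma mul_submodule A B : is_submodule A -> is_submodule (ideal_mul A B).
Proof.
move=> [_ _ AM]; split.
- by exists 0%N, (fun=> 0), (fun=> 0); split=> [[]|[]|] //; rewrite big_ord0.
- move=> _ _ [m [a [b [Aa Bb ->]]]] [n [a' [b' [Aa' Bb' ->]]]].
  pose u (p : 'I_m -> K) (q : 'I_n -> K) (k : 'I_(m + n)) :=
    match split k with inl i => p i | inr j => q j end.
  exists (m + n)%N, (u a a'), (u b b'); split.
  + by rewrite /u => k; case: split.
  + by rewrite /u => k; case: split.
  + rewrite big_split_ord /=; congr (_ + _); apply: eq_bigr => i _.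
      by rewrite /u (unsplitK (inl i)).
    by rewrite /u (unsplitK (inr i)).
- move=> d _ [m [a [b [Aa Bb ->]]]].
  exists m, (fun i => d%:F * a i), b; split=> // [i|]; first exact: AM.
  by rewrite mulr_sumr; apply: eq_bigr => i _; rewrite mulrA.
Qed.

Lemma mem_ideal_mul A B x y : A x -> B y -> ideal_mul A B (x * y).
Proof.
by move=> Ax By; exists 1%N, (fun=> x), (fun=> y); split=> //; rewrite big_ord1.
Qed.

Lemma mul_sub_left A B :
  is_submodule A -> B `<=` @dom _ -> ideal_mul A B `<=` A.
Proof.
move=> sA BD _ [n [a [b [Aa Bb ->]]]]; apply: submodule_sum => // i.
by have [c _ <-] := BD _ (Bb i); rewrite mulrC; case: sA => _ _; exact.
Qed.

(** All that the main argument needs of a t-splitting [dD = (AB)_t], put in terms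
    of the v-operation: since the t-closure is contained in the v-closure, [d]
    lies in [(AB)_v], which is inside [A_v] because [B] is integral. *)
Lemma t_splitting_v (S : {pred D}) d : t_splitting S -> d != 0 ->
  exists A B, [/\ v_op A d%:F,
    forall a b, A a -> B b -> dom (a * b / d%:F),
    exists2 s, s \in S & v_op B s%:F
  & forall s, s \in S -> v_op (ideal_add A (principal s)) 1].
Proof.
move=> tS d0; have [A [B [[[sA _ _] AD] [_ BD] dE [s Ss Bs] AS]]] := tS d d0.
have ABA := mul_sub_left sA BD; have dF0 : d%:F != 0 by rewrite tofrac_eq0.
exists A, B; split=> //.
- apply/(v_opS ABA)/t_op_sub_v_op; rewrite -dE.
  by exists 1; rewrite ?mulr1 // -(rmorph1 (@tofrac _)); exact: dom_tofrac.
- move=> a b Aa Bb; have [->|ab0] := eqVneq (a * b) 0.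
    by rewrite mul0r; exact: dom0.
  have : principal d (a * b).
    rewrite dE; apply: integral_sub_t_op => //; last exact: mem_ideal_mul.
    + exact: mul_submodule.
    + by move=> x /ABA/AD.
  by case=> x Dx <-; rewrite mulrC mulKf.
- by exists s => //; exact: t_op_sub_v_op.
- move=> t St; apply: t_op_sub_v_op; rewrite AS // -(rmorph1 (@tofrac _)).
  exact: dom_tofrac.
Qed.

(** If [I^{-1} = D] then [(I D_S)^{-1} = D_S]. Writing [x = a / d] and splitting
    [d] into [A] and [B], the hypothesis on [A] and [I^{-1} = D] put [a] in
    [A_v]; an element of [S] in [B_v] then clears the denominator of [x]. *)
Lemma fraction_inv_local (S : mulrClosed D) I x :
  0 \notin S -> t_splitting S -> I `<=` @dom _ -> ideal_inv I `<=` @dom _ ->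
  (forall y, I y -> x * y \in is_S_fraction S) -> x \in is_S_fraction S.
Proof.
move=> S0 tS ID invI xI.
have SN0 s : s \in S -> s%:F != 0 :> K.
  by move=> Ss; rewrite tofrac_eq0; apply: contraNneq S0 => <-.
pose a := \n_(repr x); pose d := \d_(repr x).
have d0 : d != 0 := denom_ratioP (repr x).
have xE : x = a%:F / d%:F := fraction_repr x.
have [A [B [vAd AB [s Ss vBs] vAS]]] := t_splitting_v tS d0.
have dF0 : d%:F != 0 by rewrite tofrac_eq0.
have vAa : v_op A a%:F.
  move=> z Az; rewrite mulrC; apply: invI => y Iy.
  have [b [t [St xyE]]] := is_S_fractionP _ _ (xI _ Iy).
  have [c _ yE] := ID _ Iy.
  (* [z a y] multiplies both [A] and [t] into [D], hence also 1, which is in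
     the v-closure of [A + tD]. *)
  rewrite -[_ * y]mul1r; apply: (vAS t St) => _ [e Ae [_ [q Dq <-] <-]].
  rewrite mulrDr; apply: domD.
    rewrite [_ * e](_ : _ = (z * e) * (a%:F * y)); last by ring.
    by apply: domM; [exact: Az | rewrite -yE; apply: domM; exact: dom_tofrac].
  have tayE : t%:F * (a%:F * y) = b%:F * d%:F.
    apply: (mulIf (invr_neq0 dF0)); rewrite mulfK //.
    rewrite -[RHS](divfK (SN0 _ St)) -xyE xE; ring.
  rewrite (_ : _ * _ = (d%:F * z) * (b%:F * q)); last first.
    rewrite (_ : _ * _ = z * q * (t%:F * (a%:F * y))); last by ring.
    by rewrite tayE; ring.
  by apply: domM; [exact: vAd | apply: domM => //; exact: dom_tofrac].
(* For [b] in [B], [b / d] is in the inverse of [A], so [a b / d] is in [D];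
   that is, [x = a / d] lies in the inverse of [B], and [s] is in [B_v]. *)
have [c _ cE] : dom (s%:F * x).
  apply: vBs => b Bb; rewrite xE mulrAC -mulrA.
  apply: vAa => e Ae; rewrite mulrC mulrA; exact: AB.
apply/is_S_fractionP; exists c, s; split=> //.
by rewrite cE mulrC mulKf // SN0.
Qed.

End Ideals.

(** * The fraction field of the localization *)

Section Localization.
Variables (D : idomainType) (S : mulrClosed D).
Hypothesis S0 : 0 \notin S.
Local Notation DS := (localization S).
Local Notation K := {fraction D}.
Local Notation L := {fraction DS}.

Let SN0 s : s \in S -> s != 0.
Proof. by move=> Ss; apply: contraNneq S0 => <-. Qed.

Fact tofrac_S_fraction d : d%:F \in is_S_fraction S.
Proof.
apply/is_S_fractionP; exists d, 1; split; first exact: rpred1.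
by rewrite rmorph1 divr1.
Qed.

Definition to_loc d : DS := Localization (tofrac_S_fraction d).

Fact to_loc_zmod_morphism : zmod_morphism to_loc.
Proof. by move=> x y; apply: val_inj; rewrite rmorphB /= rmorphB. Qed.

Fact to_loc_monoid_morphism : monoid_morphism to_loc.
Proof.
by split=> [|x y]; apply: val_inj; rewrite ?rmorph1 ?rmorphM /= ?rmorph1 ?rmorphM.
Qed.

HB.instance Definition _ :=
  GRing.isZmodMorphism.Build D DS to_loc to_loc_zmod_morphism.
HB.instance Definition _ :=
  GRing.isMonoidMorphism.Build D DS to_loc to_loc_monoid_morphism.

Lemma to_loc_inj : injective to_loc.
Proof. by move=> x y /(congr1 val)/= /eqP; rewrite tofrac_eq => /eqP. Qed.

Lemma loc_eq_frac (x : DS) : exists a s, s \in S /\ to_loc s * x = to_loc a.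
Proof.
have [a [s [Ss xE]]] := is_S_fractionP _ _ (valP x).
exists a, s; split=> //; apply: val_inj; rewrite rmorphM /= [loc_val x]xE.
by rewrite mulrC divfK // tofrac_eq0 SN0.
Qed.

Lemma loc_common_denominator n (g : 'I_n -> DS) :
  exists s (c : 'I_n -> D), s \in S /\ forall i, to_loc s * g i = to_loc (c i).
Proof.
have /choice [u uP] : forall i : 'I_n, exists p : D * D,
    p.2 \in S /\ to_loc p.2 * g i = to_loc p.1.
  by move=> i; have [a [s sP]] := loc_eq_frac (g i); exists (a, s).
exists (\prod_i (u i).2), (fun i => (u i).1 * \prod_(j | j != i) (u j).2).
split=> [|i]; first by apply: rpred_prod => i _; case: (uP i).
by rewrite (bigD1 i) //= !rmorphM /= mulrAC; case: (uP i) => _ ->.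
Qed.

(** Since [D] and [D_S] have the same quotient field, the map extending
    [to_loc] to fractions is an isomorphism; the last clause says that it carries
    the fractions with denominator in [S] onto [D_S], which is how membership
    in [D_S] is transported between the two fraction fields. *)
Lemma fraction_loc_iso : exists phi : {rmorphism K -> L},
  [/\ forall d, phi d%:F = (to_loc d)%:F,
      forall y, exists x, y = phi x
    & forall x, dom (phi x) <-> x \in is_S_fraction S].
Proof.
have inj : injective (@tofrac DS \o to_loc).
  by move=> x y /eqP /=; rewrite tofrac_eq => /eqP/to_loc_inj.
have [phi phiE] := fraction_extension inj; rewrite /= in phiE.
have phi_loc (x : DS) : phi (val x) = x%:F.
  have [a [s [Ss xE]]] := is_S_fractionP _ _ (valP x).
  have s0 : s%:F != 0 :> K by rewrite tofrac_eq0 SN0.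
  have p0 : phi s%:F != 0 by rewrite fmorph_eq0.
  apply: (mulfI p0); rewrite -rmorphM xE mulrC divfK // !phiE -rmorphM.
  by congr (_%:F); apply: val_inj; rewrite rmorphM /= [loc_val x]xE mulrC divfK.
exists phi; split=> // [y|x].
  exists (val \n_(repr y) / val \d_(repr y)).
  by rewrite fmorph_div !phi_loc -fraction_repr.
split=> [[y _ yE]|Sx]; last by exists (Localization Sx); rewrite -?phi_loc.
by have /fmorph_inj <- : phi (val y) = phi x; [rewrite phi_loc | exact: valP].
Qed.

End Localization.

(** * Localization of v-domains *)

Theorem theorem0p7 (D : idomainType) (S : mulrClosed D) (S0 : 0 \notin S)
    (tS : t_splitting S) (vD : v_domain D) :
  v_domain (localization S).
Proof.
have [phi [phiE phi_surj phi_dom]] := fraction_loc_iso S0.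
move=> A' [[_ [x0 Ax0 x0N0] _] A'D] [n [g A'E]].
apply/seteqP; split; last exact: dom_inv_mul.
have A'g i : A' (g i) by rewrite A'E; exact: span_gen.
have /choice [h hE] : forall i, exists t, t%:F = g i.
  by move=> i; have [t _ <-] := A'D _ (A'g i); exists t.
have [s [c [Ss cE]]] := loc_common_denominator S0 h.
(* [A'] is also generated by the images of the [c i], as [s] is a unit of
   [D_S]. *)
have phis i : phi (c i)%:F = phi s%:F * g i.
  by rewrite !phiE -hE -rmorphM cE.
have s0 : phi s%:F != 0.
  by rewrite fmorph_eq0 tofrac_eq0; apply: contraNneq S0 => <-.
have [i ci0] : exists i, c i != 0.
  apply: contrapT => nc; case/eqP: x0N0.
  move: Ax0; rewrite A'E => -[e ->]; apply: big1 => i _.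
  suff -> : g i = 0 by rewrite mulr0.
  apply: (mulfI s0); rewrite mulr0 -phis; apply/eqP.
  by rewrite fmorph_eq0 tofrac_eq0; apply: contra_notT nc => ci; exists i.
pose A := ideal_span (fun j => (c j)%:F).
have iA : integral_ideal A := span_integral ci0.
have fA : fin_gen A by exists n, (fun j => (c j)%:F).
have invA : ideal_inv (ideal_mul A (ideal_inv A)) `<=` @dom _ by rewrite vD.
have phiA a : A a -> A' (phi a).
  move=> [e ->]; rewrite A'E; exists (fun j => to_loc S (e j * s)).
  rewrite rmorph_sum; apply: eq_bigr => j _.
  by rewrite -phiE !rmorphM phis mulrA.
have phi_inv b : ideal_inv A b -> ideal_inv A' (phi b).
  move=> Ab y; rewrite A'E => -[e ->]; rewrite mulr_sumr.
  apply: dom_sum => j; rewrite mulrCA; apply: domM; first exact: dom_tofrac.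
  have [d _ dE] := Ab _ (span_gen (fun j => (c j)%:F) j).
  have -> : phi b * g j = phi (d%:F / s%:F).
    by rewrite dE fmorph_div rmorphM phis mulrCA [RHS]mulrC mulKf.
  by apply/phi_dom/is_S_fractionP; exists d, s.
move=> y yA; have [x yE] := phi_surj y; rewrite yE.
apply/phi_dom; apply: (fraction_inv_local S0 tS (@mul_inv_dom _ A) invA).
move=> _ [m [a [b [Aa Ab ->]]]]; apply/phi_dom; rewrite rmorphM -yE; apply: yA.
exists m, (phi \o a), (phi \o b); split=> [j|j|]; [exact: phiA|exact: phi_inv|].
by rewrite rmorph_sum; apply: eq_bigr => j _; rewrite rmorphM.
Qed.
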